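(* Let $L$ be a loop with Nuclear-holomorph $H(L)$. Then $L$ is an extra-SEL if and only if $H(L)$ is an extra-SEL.
   Context: Mappings are written on the right, so $\alpha\beta$ means first $\alpha$, then $\beta$. For a loop $(L,\cdot)$ let $Aum(L,\cdot)$ be its automorphism group. The holomorph $H(L)=(H,\circ)$ is the loop on the set $H$ of pairs $(\alpha,x)$ with $\alpha\in Aum(L,\cdot)$, $x\in L$, with operation $(\alpha,x)\circ(\beta,y)=(\alpha\beta,\ x\beta\cdot y)$. The symbol $x^{-1}$ denotes the two-sided inverse of $x$ (assumed to exist in $L$). The nucleus $N(L)$ is the set of $a\in L$ with $a\cdot xy=ax\cdot y$, $x\cdot ay=xa\cdot y$, $x\cdot ya=xy\cdot a$ for all $x,y\in L$. $H(L)$ is called a Nuclear-holomorph of $L$ if $x^{-1}\cdot x\alpha\in N(L)$ or $x\alpha\cdot x^{-1}\in N(L)$ for all $x\in L$ and $\alpha\in Aum(L,\cdot)$. An extra loop is a loop satisfying the identity $(xy\cdot z)x=x(y\cdot zx)$. A loop is a Smarandache extra loop (SEL) if it has at least one non-trivial subloop that is an extra loop. An extra-SEL is a loop that is both an extra loop and a SEL. *)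

(* Defs.v *)
From HB Require Import structures.
From mathcomp Require Import ssreflect ssrfun ssrbool monoid.
From Stdlib Require Import FunctionalExtensionality ProofIrrelevance.

Set Implicit Arguments.
Unset Strict Implicit.
Unset Printing Implicit Defensive.

Local Open Scope group_scope.

(* mathcomp's [umagmaType] and [groupType] require a choice structure on the
   carrier; loops are built on [baseUMagmaType], which does not. *)
HB.mixin Record isLoop L of BaseUMagma L := {
  loop_mul1x : left_id (one : L) mul;
  loop_mulx1 : right_id (one : L) mul;
  loop_ldiv : forall a b : L, exists! x : L, a * x = b;
  loop_rdiv : forall a b : L, exists! x : L, x * a = b
}.

#[short(type="loopType")]
HB.structure Definition Loop := {L of isLoop L & BaseUMagma L}.

Definition extra_loop (L : loopType) : Prop :=
  forall x y z : L, x * y * z * x = x * (y * (z * x)).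

(* Closure under both divisions is not automatic in an infinite loop. *)
Record subloop (L : loopType) := Subloop {
  subloop_mem :> L -> Prop;
  subloop1 : subloop_mem 1;
  subloopM : forall x y, subloop_mem x -> subloop_mem y -> subloop_mem (x * y);
  subloop_ldiv : forall a x,
    subloop_mem a -> subloop_mem (a * x) -> subloop_mem x;
  subloop_rdiv : forall a x,
    subloop_mem a -> subloop_mem (x * a) -> subloop_mem x
}.

Definition subloop_sort (L : loopType) (S : subloop L) : Type := {x : L | S x}.

Section SubloopIsLoop.
Variables (L : loopType) (S : subloop L).
Implicit Types u v : subloop_sort S.

Definition subloop_mul u v : subloop_sort S :=
  exist _ (sval u * sval v) (subloopM (svalP u) (svalP v)).

Definition subloop_one : subloop_sort S := exist _ 1 (subloop1 S).

HB.instance Definition _ := hasMul.Build (subloop_sort S) subloop_mul.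
HB.instance Definition _ := hasOne.Build (subloop_sort S) subloop_one.

Lemma subloop_val_inj u v : sval u = sval v -> u = v.
Proof.
case: u v => [x Sx] [y Sy] /= exy; subst y.
by rewrite (proof_irrelevance _ Sx Sy).
Qed.

Lemma subloop_mul1x : left_id (one : subloop_sort S) mul.
Proof. by move=> u; apply: subloop_val_inj; rewrite /= loop_mul1x. Qed.

Lemma subloop_mulx1 : right_id (one : subloop_sort S) mul.
Proof. by move=> u; apply: subloop_val_inj; rewrite /= loop_mulx1. Qed.

Lemma subloop_ldiv_ex u v : exists! w : subloop_sort S, u * w = v.
Proof.
have [x [ex ux]] := loop_ldiv (sval u) (sval v).
have Sx : S x by apply: (subloop_ldiv (svalP u)); rewrite ex; exact: svalP.
exists (exist _ x Sx); split; first exact: subloop_val_inj.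
by move=> w ew; apply: subloop_val_inj; apply: ux; rewrite -ew.
Qed.

Lemma subloop_rdiv_ex u v : exists! w : subloop_sort S, w * u = v.
Proof.
have [x [ex ux]] := loop_rdiv (sval u) (sval v).
have Sx : S x by apply: (subloop_rdiv (svalP u)); rewrite ex; exact: svalP.
exists (exist _ x Sx); split; first exact: subloop_val_inj.
by move=> w ew; apply: subloop_val_inj; apply: ux; rewrite -ew.
Qed.

HB.instance Definition _ := isLoop.Build (subloop_sort S)
  subloop_mul1x subloop_mulx1 subloop_ldiv_ex subloop_rdiv_ex.

End SubloopIsLoop.

(* Non-trivial means different from {1}; the whole loop is allowed.  If proper
   subloops were required, an extra loop such as Z/3, whose only subloops are
   {1} and itself, would not be an extra-SEL, whereas its holomorph S_3 would. *)
Definition nontrivial_subloop (L : loopType) (S : subloop L) : Prop :=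
  exists2 x : L, S x & x <> 1.

Definition smarandache_extra_loop (L : loopType) : Prop :=
  exists2 S : subloop L, nontrivial_subloop S & extra_loop (subloop_sort S).

Definition extra_SEL (L : loopType) : Prop :=
  extra_loop L /\ smarandache_extra_loop L.

Definition nucleus (L : loopType) (a : L) : Prop :=
  forall x y : L,
    [/\ a * (x * y) = a * x * y,
        x * (a * y) = x * a * y &
        x * (y * a) = x * y * a].

Record automorphism (L : loopType) := Automorphism {
  aut_fun :> L -> L;
  aut_bij : bijective aut_fun;
  autM : {morph aut_fun : x y / x * y}
}.

Lemma aut_ext (L : loopType) (f g : automorphism L) : f =1 g -> f = g.
Proof.
case: f g => [f bf mf] [g bg mg] /= fg.
have efg : f = g by apply: functional_extensionality.
subst g.
by rewrite (proof_irrelevance _ bf bg) (proof_irrelevance _ mf mg).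
Qed.

Lemma aut1 (L : loopType) (f : automorphism L) : f 1 = 1.
Proof.
have [x [_ ux]] := loop_ldiv (f 1) (f 1).
have e1 : x = 1 by apply: ux; rewrite loop_mulx1.
by rewrite -[RHS]e1; symmetry; apply: ux; rewrite -autM loop_mulx1.
Qed.

Definition aut_id (L : loopType) : automorphism L :=
  @Automorphism L id (Bijective (frefl _) (frefl _)) (fun _ _ => erefl).

Lemma aut_comp_morph (L : loopType) (f g : automorphism L) :
  {morph (g \o f) : x y / x * y}.
Proof. by move=> x y /=; rewrite !autM. Qed.

(* Mappings act on the right: [aut_comp f g] is [f] followed by [g]. *)
Definition aut_comp (L : loopType) (f g : automorphism L) : automorphism L :=
  Automorphism (bij_comp (aut_bij g) (aut_bij f)) (aut_comp_morph f g).

Lemma aut_inv_ex (L : loopType) (f : automorphism L) :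
  exists g : automorphism L, cancel f g /\ cancel g f.
Proof.
have [g fK gK] := aut_bij f.
have gM : {morph g : x y / x * y}.
  by move=> x y; apply: (can_inj fK); rewrite autM !gK.
by exists (Automorphism (Bijective gK fK) gM).
Qed.

Definition holomorph (L : loopType) : Type := (automorphism L * L)%type.

Section HolomorphIsLoop.
Variable L : loopType.
Implicit Types p q : holomorph L.

Definition holomorph_mul p q : holomorph L :=
  (aut_comp p.1 q.1, q.1 p.2 * q.2).

Definition holomorph_one : holomorph L := (aut_id L, 1).

HB.instance Definition _ := hasMul.Build (holomorph L) holomorph_mul.
HB.instance Definition _ := hasOne.Build (holomorph L) holomorph_one.

Lemma holomorph_mul1x : left_id (one : holomorph L) mul.
Proof.
move=> [f x]; rewrite /mul /= /holomorph_mul /= aut1 loop_mul1x.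
by congr pair; apply: aut_ext.
Qed.

Lemma holomorph_mulx1 : right_id (one : holomorph L) mul.
Proof.
move=> [f x]; rewrite /mul /= /holomorph_mul /= loop_mulx1.
by congr pair; apply: aut_ext.
Qed.

Lemma holomorph_ldiv_ex p q : exists! r : holomorph L, p * r = q.
Proof.
case: p q => [f x] [g y]; have [f' [fK f'K]] := aut_inv_ex f.
have [z [ez uz]] := loop_ldiv (aut_comp f' g x) y.
exists (aut_comp f' g, z); split.
  rewrite /mul /= /holomorph_mul /= ez; congr pair.
  by apply: aut_ext => t /=; rewrite fK.
move=> [h w]; rewrite /mul /= /holomorph_mul /= => -[eg ew].
have eh : aut_comp f' g = h by apply: aut_ext => t /=; rewrite -eg /= f'K.
by rewrite eh in uz *; rewrite (uz w ew).
Qed.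

Lemma holomorph_rdiv_ex p q : exists! r : holomorph L, r * p = q.
Proof.
case: p q => [f x] [g y]; have [f' [fK f'K]] := aut_inv_ex f.
have [z [ez uz]] := loop_rdiv x y.
exists (aut_comp g f', f' z); split.
  rewrite /mul /= /holomorph_mul /= f'K ez; congr pair.
  by apply: aut_ext => t /=; rewrite f'K.
move=> [h w]; rewrite /mul /= /holomorph_mul /= => -[eg ew].
congr pair; last by rewrite (uz _ ew) fK.
by apply: aut_ext => t /=; rewrite -eg /= fK.
Qed.

HB.instance Definition _ := isLoop.Build (holomorph L)
  holomorph_mul1x holomorph_mulx1 holomorph_ldiv_ex holomorph_rdiv_ex.

End HolomorphIsLoop.

Definition two_sided_inverse (L : loopType) (inv : L -> L) : Prop :=
  forall x : L, inv x * x = 1 /\ x * inv x = 1.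

Definition nuclear_holomorph (L : loopType) (inv : L -> L) : Prop :=
  forall (x : L) (f : automorphism L),
    nucleus (inv x * f x) \/ nucleus (f x * inv x).

(* Main.v *)
Require Import Defs.
From mathcomp Require Import ssreflect ssrfun ssrbool monoid.
From Stdlib Require Import Classical.

(** An extra loop is an extra-SEL exactly when it has an element other than 1,
    because the whole loop is then a non-trivial extra subloop.  The holomorph
    is trivial exactly when [L] is, since the trivial loop has no automorphism
    but the identity, so the theorem reduces to: [L] is extra if and only if
    its holomorph is.

    From the holomorph to [L] this is the embedding of [x] as [(id, x)].
    Conversely, expanding the extra identity of the holomorph at [(a, x)],
    [(b, y)], [(c, z)] leaves in the second coordinate, with [d] the
    automorphism [b] then [c] then [a] and with [y], [z] replaced by images of
    themselves, the identity
      [((x d * y) * z) * x = x d * (y * (z * x))],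
    which is the extra identity of [L] except that [x d] stands for the outer
    left [x].  An extra loop has the inverse property, so the nuclear condition
    says that [x d] is [x * n] or [n * x] with [n] in the nucleus, and the
    factor [n] can be moved through the extra identity
    ([extra_identity_nuclear_shift]). *)

Local Open Scope group_scope.

Section ExtraLoop.
Context {L : loopType} (exL : extra_loop L).

Lemma extra_mulKV (x x' w : L) : x * x' = 1 -> x * (x' * w) = w.
Proof.
move=> xx'; have [z [<- _]] := loop_rdiv x w.
by rewrite -exL xx' loop_mul1x.
Qed.

Lemma extra_mulVK (x x' w : L) : x' * x = 1 -> w * x' * x = w.
Proof.
move=> x'x; have [y [<- _]] := loop_ldiv x w.
by rewrite exL x'x loop_mulx1.
Qed.

(** A nuclear factor on either side of the outer left [x] passes out of the
    extra identity: on the left it factors out of both sides, and on the right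
    it is absorbed into [y]. *)
Lemma extra_identity_nuclear_shift (n x x' y z : L) :
    nucleus n -> x' = x * n \/ x' = n * x ->
  x' * y * z * x = x' * (y * (z * x)).
Proof.
move=> nN; have nl u v : n * (u * v) = n * u * v by case: (nN u v).
case=> ->.
  have nm u v : u * (n * v) = u * n * v by case: (nN u v).
  by rewrite -nm exL -nl nm.
by rewrite -!nl exL nl.
Qed.

End ExtraLoop.

Lemma extra_loop_holomorph (L : loopType) (inv : L -> L) :
    two_sided_inverse inv -> nuclear_holomorph inv ->
  extra_loop L -> extra_loop (holomorph L).
Proof.
move=> invP nuc exL [a x] [b y] [c z].
rewrite /mul /= /holomorph_mul /=; congr pair; first exact: aut_ext.
rewrite !autM; have [Vx xV] := invP x.
have [nN|nN] := nuc x (aut_comp (aut_comp b c) a).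
  apply: (extra_identity_nuclear_shift exL _ _ _ _ _ nN); left.
  by rewrite (extra_mulKV exL _ _ _ xV).
apply: (extra_identity_nuclear_shift exL _ _ _ _ _ nN); right.
by rewrite (extra_mulVK exL _ _ _ Vx).
Qed.

Lemma extra_loop_of_holomorph (L : loopType) :
  extra_loop (holomorph L) -> extra_loop L.
Proof.
move=> exH x y z; pose i (t : L) : holomorph L := (aut_id L, t).
exact: (congr1 snd (exH (i x) (i y) (i z))).
Qed.

(** Over a trivial [L] every automorphism is the identity, hence the holomorph
    cannot acquire elements from the automorphism group alone. *)
Lemma holomorph_nontrivial (L : loopType) :
  (exists x : L, x <> 1) <-> (exists p : holomorph L, p <> 1).
Proof.
split=> [[x x1]|[[f x] p1]].
  by exists (aut_id L, x) => /(congr1 snd).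
apply: NNPP => noL; apply: p1.
have triv (t : L) : t = 1 by apply: NNPP => t1; apply: noL; exists t.
rewrite (triv x); congr pair.
by apply: aut_ext => t; rewrite (triv t) aut1.
Qed.

Definition whole_subloop (L : loopType) : subloop L :=
  @Subloop L (fun _ => True) I (fun _ _ _ _ => I)
    (fun _ _ _ _ => I) (fun _ _ _ _ => I).

Lemma extra_SEL_iff_nontrivial (L : loopType) :
  extra_SEL L <-> extra_loop L /\ exists x : L, x <> 1.
Proof.
split=> -[exL]; first by case=> S [x _ x1] _; split=> //; exists x.
case=> x x1; split=> //; exists (whole_subloop L); first by exists x.
by move=> u v w; apply: subloop_val_inj; apply: exL.
Qed.

Theorem theorem3p14 (L : loopType) (inv : L -> L)
    (inv_two_sided : two_sided_inverse inv)
    (nuclear : nuclear_holomorph inv) :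
  extra_SEL L <-> extra_SEL (holomorph L).
Proof.
rewrite !extra_SEL_iff_nontrivial holomorph_nontrivial.
split=> -[ex nt]; split=> //; first exact: extra_loop_holomorph ex.
exact: extra_loop_of_holomorph.
Qed.
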